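(* Let $G$ be a connected nontrivial graph with $m$ vertices and let $n\geq 2$. Then $$\lambda'(G\boxtimes P_n)=\min\{(3n-2)\lambda(G),\ m+2e(G),\ 2\xi(G)+4,\ 5\delta(G)+1\}.$$
   Context: All graphs are finite, simple and undirected; ''nontrivial'' means having at least two vertices. $P_n$, $C_n$, $K_n$ denote the path, cycle and complete graph on $n$ vertices. For a graph $G$: $e(G)=|E(G)|$; $\delta(G)$ is the minimum degree; $\lambda(G)$ is the edge-connectivity (minimum size of an edge set whose removal disconnects $G$); for an edge $uv$, its edge-degree is $d_G(u)+d_G(v)-2$, and $\xi(G)$ is the minimum edge-degree over all edges of $G$. A restricted edge-cut of a connected graph $G$ is a set $S\subseteq E(G)$ such that $G-S$ is disconnected and every component of $G-S$ has at least $2$ vertices; the restricted edge-connectivity $\lambda'(G)$ is the minimum cardinality of a restricted edge-cut (it exists, e.g., whenever $G$ has at least four vertices and is not a star, and then $\lambda'(G)\le\xi(G)$). The strong product $G\boxtimes H$ has vertex set $V(G)\times V(H)$, with $(x_1,y_1)$ and $(x_2,y_2)$ adjacent iff either $x_1=x_2$ and $y_1y_2\in E(H)$, or $y_1=y_2$ and $x_1x_2\in E(G)$, or $x_1x_2\in E(G)$ and $y_1y_2\in E(H)$. *)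

(* Defs.v *)
(* Simple graphs = symmetric irreflexive relations on a finType. *)
From mathcomp Require Import all_boot.
Set Implicit Arguments. Unset Strict Implicit. Unset Printing Implicit Defensive.

Section Graphs.
Variable T : finType.
Implicit Types (e : rel T) (S : {set {set T}}).

Definition edges e : {set {set T}} :=
  [set [set p.1; p.2] | p in [set p : T * T | e p.1 p.2]].

Definition nedges e : nat := #|edges e|.

Definition deg e (x : T) : nat := #|[set y | e x y]|.

(* minimum degree delta(G) (default #|T| only for the empty vertex set) *)
Definition min_deg e : nat := \big[minn/#|T|]_(x : T) deg e x.

(* minimum edge-degree xi(G): min over edges uv of d(u)+d(v)-2
   (default only used when G has no edge) *)
Definition min_edge_deg e : nat :=
  \big[minn/(2 * #|T|)]_(p : T * T | e p.1 p.2) (deg e p.1 + deg e p.2 - 2).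

Definition del_edges e S : rel T := fun x y => e x y && ([set x; y] \notin S).

Definition disconnected (f : rel T) : bool := ~~ [forall x, forall y, connect f x y].

Definition component (f : rel T) (x : T) : {set T} := [set y | connect f x y].

Definition edge_cut e S : bool := (S \subset edges e) && disconnected (del_edges e S).

Definition restricted_edge_cut e S : bool :=
  edge_cut e S && [forall x, 1 < #|component (del_edges e S) x|].

(* lambda(G): minimum size of an edge cut (default #|E(G)| if none exists) *)
Definition edge_conn e : nat :=
  \big[minn/nedges e]_(S : {set {set T}} | edge_cut e S) #|S|.

(* lambda'(G): minimum size of a restricted edge cut (default #|E(G)| if none) *)
Definition redge_conn e : nat :=
  \big[minn/nedges e]_(S : {set {set T}} | restricted_edge_cut e S) #|S|.

Definition connected e : Prop := forall x y : T, connect e x y.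
End Graphs.

Definition path_rel (n : nat) : rel 'I_n :=
  fun i j => (i.+1 == j :> nat) || (j.+1 == i :> nat).

Definition strong (T1 T2 : finType) (e1 : rel T1) (e2 : rel T2) : rel (T1 * T2) :=
  fun p q => [|| (p.1 == q.1) && e2 p.2 q.2,
                 (p.2 == q.2) && e1 p.1 q.1
               | e1 p.1 q.1 && e2 p.2 q.2].
Arguments path_rel n : clear implicits.

(* Main.v *)
Require Import Defs.
From mathcomp Require Import all_boot all_order zify.
Set Implicit Arguments. Unset Strict Implicit. Unset Printing Implicit Defensive.
Import Order.TTheory.

(* Cut the product along a vertex set X with slices X_0, ..., X_m in the m + 1 copies of G.
   Write N[u] for the closed neighbourhood, boundary A B for the sum over u in A of
   |N[u] \ B|, and crossing A B := boundary A B + boundary B A.  Since the closed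
   neighbourhood of (u, i) is N[u] x N[i], the cut has
     sum_k boundary X_k X_k + sum_k crossing X_k X_(k+1)
   edges.
   - If no slice is empty or full, each boundary is at least lambda and each crossing at
     least 2 lambda: by submodularity, or by counting degrees when the two slices are
     disjoint or cover V(G).
   - If there are an empty and a full slice, the crossings between them add up to at least
     the sum of all |N[u]|, that is m + 2e.
   - Otherwise, up to complement and reversal of the path, an empty slice is followed by a
     nonempty slice A.  Either A spans an edge, and A alone costs at least 2 xi + 4, or the
     next slice is nonempty, and the two together cost at least 5 delta + 1.
   The four upper bounds come from sets A x {0, ..., l - 1}: take for A a minimum cut side
   with l = m + 1, then V(G) and an edge with l = 1, and finally a vertex with l = 2
   (for m = 1 the last one even costs 4 delta only). *)

Lemma bigminn_le (I : finType) (P : pred I) (F : I -> nat) d i :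
  P i -> \big[minn/d]_(j | P j) F j <= F i.
Proof. by move=> Pi; rewrite -minEnat -leEnat bigmin_le_cond. Qed.

Lemma bigminn_attained (I : finType) (P : pred I) (F : I -> nat) d i :
  P i -> (forall j, P j -> F j <= d) ->
  exists2 j, P j & \big[minn/d]_(j | P j) F j = F j.
Proof.
by move=> Pi Fd; rewrite -minEnat; have [j Pj] := eq_bigmin i P F Pi Fd; exists j.
Qed.

Lemma leq_sum_subrange (F : nat -> nat) m n i j : m <= i -> j <= n ->
  \sum_(i <= k < j) F k <= \sum_(m <= k < n) F k.
Proof. exact: (le_big_nat leqnn (fun x y => leq_addr y x)). Qed.

Lemma eq_set2 (T : finType) (a b c d : T) :
  ([set a; b] == [set c; d]) = (a == c) && (b == d) || (a == d) && (b == c).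
Proof.
apply/eqP/idP => [E|/orP[]/andP[/eqP-> /eqP->] //]; last exact: setUC.
have : [&& a \in [set c; d], b \in [set c; d], c \in [set a; b] & d \in [set a; b]].
  by rewrite -E set21 set22 E set21 set22.
rewrite !inE ![c == _]eq_sym ![d == _]eq_sym.
by case: (a == c); case: (a == d); case: (b == c); case: (b == d).
Qed.

Section Degrees.
Variables (T : finType) (e : rel T).
Implicit Types (u v : T).

Lemma deg_gt0 u v : e u v -> 0 < deg e u.
Proof. by move=> uv; apply/card_gt0P; exists v; rewrite inE. Qed.

Lemma min_deg_le u : min_deg e <= deg e u.
Proof. exact: bigminn_le. Qed.

Lemma min_deg_attained : 0 < #|T| -> exists u, deg e u = min_deg e.
Proof.
case/card_gt0P=> x _; have deg_le u : predT u -> deg e u <= #|T| by rewrite max_card.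
by have [u _ min_u] := bigminn_attained (isT : predT x) deg_le; exists u.
Qed.

Lemma min_edge_deg_le u v : e u v -> min_edge_deg e <= deg e u + deg e v - 2.
Proof. exact: (@bigminn_le _ (fun p : T * T => e p.1 p.2) _ _ (u, v)). Qed.

Lemma min_edge_deg_attained x y : e x y ->
  exists u v, e u v /\ deg e u + deg e v - 2 = min_edge_deg e.
Proof.
move=> exy; have deg_le u : deg e u <= #|T| by apply: max_card.
have edge_deg_le (p : T * T) : e p.1 p.2 -> deg e p.1 + deg e p.2 - 2 <= 2 * #|T|.
  by move=> _; have := deg_le p.1; have := deg_le p.2; lia.
have [[u v] euv min_uv] := bigminn_attained (exy : e (x, y).1 (x, y).2) edge_deg_le.
by exists u, v.
Qed.

Lemma sum_deg : symmetric e -> irreflexive e -> \sum_u deg e u = 2 * nedges e.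
Proof.
move=> e_sym e_irr; transitivity #|[set p : T * T | e p.1 p.2]|.
  rewrite -sum1_card; under eq_bigr do rewrite /deg -sum1_card.
  by rewrite pair_big_dep /=; apply: eq_bigl => -[u v]; rewrite !inE.
rewrite -sum1_card (partition_big_imset (fun p => [set p.1; p.2])) /= -/(edges e).
rewrite mulnC -sum_nat_const; apply: eq_bigr => _ /imsetP[[x y] + ->].
rewrite inE sum1_card /= => exy.
have neq_xy : x != y by apply: contraTneq exy => ->; rewrite e_irr.
rewrite (_ : 2 = #|[set (x, y); (y, x)]|); last by rewrite cards2 xpair_eqE negb_and neq_xy.
apply: eq_card => -[u v]; rewrite !inE unfold_in /= inE eq_set2 !xpair_eqE andb_idl //.
by case/orP=> /andP[/eqP-> /eqP->]; rewrite // e_sym.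
Qed.

End Degrees.

Section Boundary.
Variables (T : finType) (e : rel T).
Implicit Types (u v : T) (A B : {set T}).

Definition closed_nbrs u : {set T} := u |: [set v | e u v].

Definition volume A : nat := \sum_(u in A) #|closed_nbrs u|.

Definition boundary A B : nat := \sum_(u in A) #|closed_nbrs u :\: B|.

Definition crossing A B : nat := boundary A B + boundary B A.

Lemma boundary_sum A B :
  boundary A B = \sum_u \sum_v [&& u \in A, v \notin B & v \in closed_nbrs u].
Proof.
rewrite /boundary big_mkcond; apply: eq_bigr => u _; case: (u \in A) => /=.
  by rewrite -sum1_card [LHS]big_mkcond; apply: eq_bigr => v _; rewrite inE; case: ifP.
by rewrite big1.
Qed.

Lemma boundary0 A : boundary set0 A = 0.
Proof. exact: big_set0. Qed.

Lemma boundaryT A : boundary A [set: T] = 0.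
Proof. by apply: big1 => u _; rewrite setDT cards0. Qed.

Lemma crossingC A B : crossing A B = crossing B A.
Proof. exact: addnC. Qed.

Lemma crossing0 A : crossing set0 A = volume A.
Proof. by rewrite /crossing boundary0; apply: eq_bigr => u _; rewrite setD0. Qed.

Lemma boundary_submodular A B :
  boundary (A :&: B) (A :&: B) + boundary (A :|: B) (A :|: B) <= crossing A B.
Proof.
rewrite /crossing !boundary_sum -!big_split leq_sum //= => u _.
rewrite -!big_split leq_sum //= => v _; case: (v \in closed_nbrs u); rewrite !inE.
  by case: (u \in A); case: (u \in B); case: (v \in A); case: (v \in B).
by rewrite !andbF.
Qed.

Section Symmetric.
Hypothesis e_sym : symmetric e.

Lemma closed_nbrs_sym u v : (v \in closed_nbrs u) = (u \in closed_nbrs v).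
Proof. by rewrite !inE eq_sym e_sym. Qed.

Lemma boundary_setC A B : boundary (~: A) (~: B) = boundary B A.
Proof.
rewrite !boundary_sum exchange_big; apply: eq_bigr => u _; apply: eq_bigr => v _.
by rewrite closed_nbrs_sym !inE negbK; do 2!case: (_ \in _).
Qed.

Lemma crossing_setC A B : crossing (~: A) (~: B) = crossing A B.
Proof. by rewrite /crossing !boundary_setC addnC. Qed.

Lemma volume_le_crossing A B : volume B <= volume A + crossing A B.
Proof.
have volB : volume B = boundary B (~: A) + boundary B A.
  by rewrite /volume -big_split; apply: eq_bigr => u _ /=; rewrite setDE setCK cardsID.
have swap : boundary B (~: A) = boundary A (~: B) by rewrite -{1}[B]setCK boundary_setC.
rewrite volB swap /crossing leq_add ?leq_addl //.
by apply: leq_sum => u _; rewrite subset_leq_card ?subsetDl.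
Qed.

End Symmetric.

Section Loopless.
Hypothesis e_irr : irreflexive e.

Lemma card_closed_nbrs u : #|closed_nbrs u| = (deg e u).+1.
Proof. by rewrite cardsU1 inE e_irr. Qed.

Lemma boundary_set1 u : boundary [set u] [set u] = deg e u.
Proof. by rewrite /boundary big_set1 setU1K // inE e_irr. Qed.

Lemma deg_lt_closed_nbrsD u A : deg e u < #|closed_nbrs u :\: A| + #|A|.
Proof.
by rewrite -card_closed_nbrs addnC -leq_subLR cardsD leq_sub2l // subset_leq_card ?subsetIr.
Qed.

Lemma volume_ge_min_deg A : #|A| * (min_deg e).+1 <= volume A.
Proof.
by rewrite -sum_nat_const leq_sum // => u _; rewrite card_closed_nbrs ltnS min_deg_le.
Qed.

Lemma boundary_ge_min_deg A B : #|A| * ((min_deg e).+1 - #|B|) <= boundary A B.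
Proof.
rewrite -sum_nat_const leq_sum // => u _; rewrite leq_subLR addnC.
exact: leq_ltn_trans (min_deg_le e u) (deg_lt_closed_nbrsD u B).
Qed.

(* One vertex of A has at least min_deg e + 1 - #|B| closed neighbours outside B;
   each other vertex of A contributes its own loop. *)
Lemma boundary_disjoint_ge_min_deg A B : A != set0 -> [disjoint A & B] ->
  min_deg e + #|A| <= boundary A B + #|B|.
Proof.
case/set0Pn=> u uA AB; rewrite /boundary (big_setD1 u) //= (cardsD1 u A) uA.
have others : #|A :\ u| <= \sum_(w in A :\ u) #|closed_nbrs w :\: B|.
  rewrite -sum1_card leq_sum // => w /setD1P[_ wA].
  by apply/card_gt0P; exists w; rewrite !inE eqxx (disjointFr AB wA).
have := deg_lt_closed_nbrsD u B; have := min_deg_le e u; lia.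
Qed.

Lemma crossing_disjoint_ge_min_deg A B : A != set0 -> B != set0 -> [disjoint A & B] ->
  2 * min_deg e <= crossing A B.
Proof.
move=> A0 B0 AB; have BA : [disjoint B & A] by rewrite disjoint_sym.
have := boundary_disjoint_ge_min_deg A0 AB; have := boundary_disjoint_ge_min_deg B0 BA.
rewrite /crossing; lia.
Qed.

End Loopless.

Lemma boundary_set2 u v : symmetric e -> irreflexive e -> e u v ->
  boundary [set u; v] [set u; v] = deg e u + deg e v - 2.
Proof.
move=> e_sym e_irr euv; have evu : e v u by rewrite e_sym.
have neq_uv : u != v by apply: contraTneq euv => ->; rewrite e_irr.
have outside w : w \in [set u; v] -> #|closed_nbrs w :\: [set u; v]| = (deg e w).-1.
  move=> wuv; rewrite cardsDS ?card_closed_nbrs // ?cards2 ?neq_uv ?subSS ?subn1 //.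
  by apply/subsetP=> z /set2P[]->; case/set2P: wuv => ->; rewrite !inE ?eqxx ?euv ?evu ?orbT.
rewrite /boundary big_setU1 ?inE //= big_set1 !outside ?set21 ?set22 //.
have := deg_gt0 euv; have := deg_gt0 evu; lia.
Qed.

Lemma volume_setT : symmetric e -> irreflexive e ->
  volume [set: T] = #|T| + 2 * nedges e.
Proof.
move=> e_sym e_irr; rewrite -sum_deg // -sum1_card -big_split /=.
by apply: eq_big => u; rewrite ?inE // card_closed_nbrs.
Qed.

End Boundary.

Section EdgeCuts.
Variables (T : finType) (e : rel T).
Implicit Types (u v x : T) (A : {set T}) (S : {set {set T}}).

Definition proper_side A : bool := (A != set0) && (A != [set: T]).

Definition no_isolated A : Prop := forall u, u \in A -> exists2 v, v \in A & e u v.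

Definition restricted_side A : Prop :=
  [/\ proper_side A, no_isolated A & no_isolated (~: A)].

Definition cut_edges A : {set {set T}} :=
  [set [set p.1; p.2] | p in
    [set p : T * T | [&& p.1 \in A, p.2 \notin A & e p.1 p.2]]].

Lemma proper_sideC A : proper_side (~: A) = proper_side A.
Proof. by rewrite /proper_side !(can2_eq setCK setCK) setC0 setCT andbC. Qed.

Lemma proper_sideP A : reflect (exists u v, u \in A /\ v \notin A) (proper_side A).
Proof.
apply: (iffP andP) => [[/set0Pn[u uA]]|[u [v [uA vA]]]].
  by rewrite -properT => /properP[_ [v _ vA]]; exists u, v.
by split; [apply/set0Pn; exists u | apply: contraNneq vA => ->; rewrite inE].
Qed.

Lemma proper_side1 x : 1 < #|T| -> proper_side [set x].
Proof.
move=> T_gt1; rewrite /proper_side -card_gt0 cards1 /=.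
by apply: contraTneq T_gt1 => xT; rewrite -cardsT -xT cards1.
Qed.

Lemma restricted_sideC A : restricted_side A -> restricted_side (~: A).
Proof. by case=> pA iA iCA; split; rewrite ?proper_sideC ?setCK. Qed.

Lemma cut_edges_sub A : cut_edges A \subset edges e.
Proof.
by apply/imsetS/subsetP => p; rewrite !inE => /and3P[].
Qed.

Lemma card_cut_edges A : #|cut_edges A| = boundary e A A.
Proof.
rewrite card_in_imset => [|[u v] [x y]].
  rewrite boundary_sum -sum1_card pair_bigA big_mkcond; apply: eq_bigr => -[u v] _ /=.
  rewrite !inE; case: (boolP (u \in A)) => //= uA; case: (boolP (v \in A)) => //= vA.
  by case: eqP vA => [->|_ _]; [rewrite uA | case: (e u v)].
rewrite !inE /= => /and3P[uA vA _] /and3P[xA yA _] /eqP.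
rewrite eq_set2 => /orP[/andP[/eqP-> /eqP->] // | /andP[/eqP uy _]].
by rewrite -uy uA in yA.
Qed.

Lemma edge_cut_leq_nedges S : edge_cut e S -> #|S| <= nedges e.
Proof. by case/andP=> /subset_leq_card. Qed.

Lemma edge_cut_component S : edge_cut e S ->
  exists x, proper_side (component (del_edges e S) x).
Proof.
case/andP=> _ /forallPn[x /forallPn[y xy]]; exists x; apply/proper_sideP.
by exists x, y; rewrite !inE connect0.
Qed.

Lemma boundary_component_le S x :
  boundary e (component (del_edges e S) x) (component (del_edges e S) x) <= #|S|.
Proof.
rewrite -card_cut_edges; apply/subset_leq_card/subsetP=> _ /imsetP[[u v] + ->].
rewrite !inE /= => /and3P[xu xv uv]; apply: contraNT xv => uvS.
by apply: connect_trans xu (connect1 _); rewrite /del_edges uv.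
Qed.

Hypothesis e_sym : symmetric e.

Lemma del_edges_sym S : symmetric (del_edges e S).
Proof. by move=> u v; rewrite /del_edges e_sym setUC. Qed.

Lemma mem_cut_edges A u v : e u v ->
  ([set u; v] \in cut_edges A) = ((u \in A) != (v \in A)).
Proof.
move=> euv; apply/imsetP/idP => [[[x y]]|].
  rewrite inE /= => /and3P[xA yA _] /eqP; rewrite eq_set2.
  by case/orP=> /andP[/eqP-> /eqP->]; rewrite xA (negbTE yA).
case uA: (u \in A); case vA: (v \in A) => // _.
  by exists (u, v); rewrite // inE /= uA vA euv.
by exists (v, u); rewrite /= 1?setUC // inE /= uA vA e_sym euv.
Qed.

Lemma edge_cut_cut_edges A : proper_side A -> edge_cut e (cut_edges A).
Proof.
case/proper_sideP=> u [v [uA vA]]; rewrite /edge_cut cut_edges_sub /=.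
have A_closed : closed (del_edges e (cut_edges A)) (mem A).
  by move=> x y /andP[exy]; rewrite mem_cut_edges // negbK => /eqP.
apply/negP => /forallP/(_ u)/forallP/(_ v)/(closed_connect A_closed) uvA.
by move: vA; rewrite -[_ \in _]uvA uA.
Qed.

Lemma edge_conn_le A : proper_side A -> edge_conn e <= boundary e A A.
Proof. by move=> pA; rewrite -card_cut_edges; apply/bigminn_le/edge_cut_cut_edges. Qed.

Lemma edge_conn_attained : 1 < #|T| ->
  exists2 B, proper_side B & boundary e B B = edge_conn e.
Proof.
move=> T_gt1; have /card_gt1P[a _] := T_gt1.
have cut_a := edge_cut_cut_edges (proper_side1 a T_gt1).
have [S cutS card_S] := bigminn_attained cut_a edge_cut_leq_nedges.
have [x pC] := edge_cut_component cutS; exists (component (del_edges e S) x) => //.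
by apply/eqP; rewrite eqn_leq edge_conn_le // andbT [edge_conn e]card_S boundary_component_le.
Qed.

Lemma connected_boundary_gt0 A : connected e -> proper_side A -> 0 < boundary e A A.
Proof.
move=> e_conn /edge_cut_cut_edges/andP[_ disc]; rewrite -card_cut_edges card_gt0.
apply: contraNneq disc => ->; apply/forallP=> x; apply/forallP=> y.
by rewrite (eq_connect (_ : _ =2 e)) // => u v; rewrite /del_edges in_set0 andbT.
Qed.

Lemma no_isolated_component S x : (forall u, 1 < #|component (del_edges e S) u|) ->
  no_isolated (component (del_edges e S) x) /\ no_isolated (~: component (del_edges e S) x).
Proof.
move=> comp_gt1; have neighbour u : exists2 v, e u v & connect (del_edges e S) x u =
    connect (del_edges e S) x v.
  have [z] : exists2 z, z != u & connect (del_edges e S) u z.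
    have := comp_gt1 u; rewrite (cardsD1 u) inE connect0 ltnS => /card_gt0P[z].
    by rewrite !inE => /andP[]; exists z.
  move=> neq_zu /connectP[[|v p] /=]; first by move=> _ E; rewrite E eqxx in neq_zu.
  case/andP=> uv _ _; exists v; first by case/andP: uv.
  exact/same_connect1r/uv/sym_connect_sym/del_edges_sym.
by split=> u; rewrite !inE; have [v uv ->] := neighbour u; exists v; rewrite ?inE.
Qed.

Hypothesis e_irr : irreflexive e.

Lemma restricted_edge_cut_cut_edges A :
  restricted_side A -> restricted_edge_cut e (cut_edges A).
Proof.
case=> pA iA iCA; rewrite /restricted_edge_cut edge_cut_cut_edges //; apply/forallP=> u.
have [v euv vA] : exists2 v, e u v & (u \in A) = (v \in A).
  case uA: (u \in A); first by have [v] := iA u uA; exists v.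
  have [|v] := iCA u; first by rewrite inE uA.
  by rewrite inE => /negbTE; exists v.
rewrite (cardD1 u) (cardD1 v) !inE connect0.
have -> : v != u by apply: contraTneq euv => ->; rewrite e_irr.
by rewrite connect1 // /del_edges euv mem_cut_edges // vA eqxx.
Qed.

Lemma redge_conn_le A : restricted_side A -> redge_conn e <= boundary e A A.
Proof.
by move=> rA; rewrite -card_cut_edges; apply/bigminn_le/restricted_edge_cut_cut_edges.
Qed.

Lemma redge_conn_attained A : restricted_side A ->
  exists2 B, restricted_side B & boundary e B B = redge_conn e.
Proof.
move=> /restricted_edge_cut_cut_edges rcutA.
have rcut_leq S : restricted_edge_cut e S -> #|S| <= nedges e.
  by case/andP=> /edge_cut_leq_nedges.
have [S /andP[cutS /forallP comp_gt1] card_S] := bigminn_attained rcutA rcut_leq.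
have [x pC] := edge_cut_component cutS; have [iC iCC] := no_isolated_component x comp_gt1.
have rC : restricted_side (component (del_edges e S) x) by split.
exists (component (del_edges e S) x) => //; apply/eqP.
by rewrite eqn_leq redge_conn_le // andbT [redge_conn e]card_S boundary_component_le.
Qed.

End EdgeCuts.

Section Connected.
Variables (T : finType) (e : rel T).
Hypotheses (e_sym : symmetric e) (e_conn : connected e) (T_gt1 : 1 < #|T|).
Implicit Types (u v : T) (A B : {set T}).

Lemma connected_no_isolated_setT : no_isolated e [set: T].
Proof.
move=> u _; have := connected_boundary_gt0 e_sym e_conn (proper_side1 u T_gt1).
rewrite /boundary big_set1 => /card_gt0P[v]; rewrite !inE => /andP[/negbTE-> uv].
by exists v; rewrite ?inE.
Qed.

Lemma connected_deg_gt0 u : 0 < deg e u.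
Proof.
by have [v _ /deg_gt0] := connected_no_isolated_setT (in_setT u).
Qed.

Lemma edge_conn_gt0 : 0 < edge_conn e.
Proof.
by have [A pA <-] := edge_conn_attained e_sym T_gt1; apply: connected_boundary_gt0.
Qed.

Hypothesis e_irr : irreflexive e.

Lemma edge_conn_le_min_deg : edge_conn e <= min_deg e.
Proof.
have [u <-] := min_deg_attained e (ltnW T_gt1).
by rewrite -boundary_set1 // edge_conn_le // proper_side1.
Qed.

Lemma crossing_ge_edge_conn A B : proper_side A -> proper_side B ->
  2 * edge_conn e <= crossing e A B.
Proof.
have disjoint_case C D : proper_side C -> proper_side D -> C :&: D = set0 ->
    2 * edge_conn e <= crossing e C D.
  move=> /andP[C0 _] /andP[D0 _] /eqP; rewrite setI_eq0 => CD.
  apply: leq_trans (crossing_disjoint_ge_min_deg e_irr C0 D0 CD).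
  by rewrite leq_mul2l edge_conn_le_min_deg.
move=> pA pB; have [AB0|AB0] := eqVneq (A :&: B) set0; first exact: disjoint_case.
have [ABT|ABT] := eqVneq (A :|: B) [set: T].
  by rewrite -crossing_setC // disjoint_case ?proper_sideC // -setCU ABT setCT.
case/andP: pA => A0 AT; apply: leq_trans (boundary_submodular e A B).
rewrite mul2n -addnn leq_add // edge_conn_le // /proper_side ?AB0 ?ABT ?andbT /=.
  by apply: contraNneq AT => ABT'; rewrite -subTset -ABT' subsetIl.
by apply: contraNneq A0 => AB0'; rewrite -subset0 -AB0' subsetUl.
Qed.

(* The vertices of A other than u and v have at least two closed neighbours each, which
   offsets the at most #|A| - 2 neighbours that u, and likewise v, may have among them. *)
Lemma one_layer_ge_min_edge_deg A u v : u \in A -> v \in A -> e u v ->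
  2 * min_edge_deg e + 4 <= volume e A + boundary e A A.
Proof.
move=> uA vA euv; have neq_vu : v != u by apply: contraTneq euv => ->; rewrite e_irr.
have vAu : v \in A :\ u by rewrite !inE neq_vu.
have others : 2 * #|A :\ u :\ v| <=
    \sum_(w in A :\ u :\ v) (#|closed_nbrs e w| + #|closed_nbrs e w :\: A|).
  rewrite mulnC -sum_nat_const leq_sum // => w _.
  by rewrite ltn_addr // card_closed_nbrs // ltnS connected_deg_gt0.
rewrite /volume /boundary -big_split (big_setD1 u) //= (big_setD1 v) //= !card_closed_nbrs //.
have cardA : #|A| = (#|A :\ u :\ v|).+2 by rewrite (cardsD1 u) uA (cardsD1 v (A :\ u)) vAu.
have := min_edge_deg_le euv; have := connected_deg_gt0 u; have := connected_deg_gt0 v.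
have := deg_lt_closed_nbrsD e_irr u A; have := deg_lt_closed_nbrsD e_irr v A.
lia.
Qed.

Lemma two_layers_ge_min_deg A B : proper_side A -> proper_side B ->
  5 * min_deg e + 1 <= volume e A + boundary e A A + crossing e A B + boundary e B B.
Proof.
move=> pA pB; have vol_A := volume_ge_min_deg e_irr A.
have bound_A : 0 < boundary e A A by rewrite connected_boundary_gt0.
have bound_B : 0 < boundary e B B by rewrite connected_boundary_gt0.
have cross_ge2 : 2 <= crossing e A B.
  by apply: leq_trans (crossing_ge_edge_conn pA pB); rewrite -{1}[2]muln1 leq_mul2l edge_conn_gt0.
have [cardA_gt4|] := ltnP 4 #|A|.
  by have := leq_mul cardA_gt4 (leqnn (min_deg e).+1); lia.
(* For |A| = 3, 4 the volume and the boundary of A suffice up to the constants above; for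
   |A| = 1, 2 the crossing grows linearly with min_deg e, at a rate depending on |B|. *)
have bound_A_deg := boundary_ge_min_deg e_irr A A.
have bound_B_deg := boundary_ge_min_deg e_irr B B.
have cross_deg := leq_add (boundary_ge_min_deg e_irr A B) (boundary_ge_min_deg e_irr B A).
rewrite -/(crossing e A B) in cross_deg.
have [cardA_gt0 cardB_gt0] : 0 < #|A| /\ 0 < #|B|.
  by case/andP: pA pB => A0 _ /andP[B0 _]; rewrite !card_gt0.
move: #|A| #|B| cardA_gt0 cardB_gt0 vol_A bound_A_deg bound_B_deg cross_deg.
case=> [|[|[|[|[|p]]]]] // q _ q_gt0 vol_A bound_A_deg bound_B_deg cross_deg _; last 2 first.
- lia.
- lia.
- case: q q_gt0 bound_B_deg cross_deg => [|[|[|q]]] // _ bound_B_deg cross_deg; nia.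
- case: q q_gt0 bound_B_deg cross_deg => [|[|q]] // _ bound_B_deg cross_deg; nia.
Qed.

End Connected.

Section Layers.
Variables (T : finType) (e : rel T).
Implicit Types (A : {set T}) (Y : nat -> {set T}).

Definition layer_cut m Y : nat :=
  \sum_(0 <= k < m.+1) boundary e (Y k) (Y k) + \sum_(0 <= k < m) crossing e (Y k) (Y k.+1).

Definition no_isolated_layers m Y : Prop := forall k, k <= m -> Y k != set0 ->
  (exists u v, [/\ u \in Y k, v \in Y k & e u v]) \/
  (exists l, [/\ l <= m, (k.+1 == l) || (l.+1 == k) & Y l != set0]).

Lemma eq_layer_cut m Y Y' : (forall k, k <= m -> Y k = Y' k) -> layer_cut m Y = layer_cut m Y'.
Proof.
by move=> eqY; congr (_ + _); apply: eq_big_nat => k /andP[_ km]; rewrite !eqY // ltnW.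
Qed.

Lemma layer_cut_rev m Y : layer_cut m (fun k => Y (m - k)) = layer_cut m Y.
Proof.
congr (_ + _); rewrite big_nat_rev; apply: eq_big_nat => k /andP[_ km] /=.
  by congr (boundary e (Y _) (Y _)); lia.
by rewrite crossingC; congr (crossing e (Y _) (Y _)); lia.
Qed.

Lemma no_isolated_layers_rev m Y :
  no_isolated_layers m Y -> no_isolated_layers m (fun k => Y (m - k)).
Proof.
move=> iY k km /(iY _ (leq_subr k m))[|[l [lm kl Yl]]]; first by left.
by right; exists (m - l); rewrite subKn //; split=> //; lia.
Qed.

Lemma layer_cut_prefix m l A : 0 < l <= m.+1 ->
  layer_cut m (fun k => if k < l then A else set0) =
  (3 * l - 2) * boundary e A A + (l <= m) * volume e A.
Proof.
case: l => // l /= lm; set Y := fun k => _.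
have Y_in k : k <= l -> Y k = A by rewrite /Y ltnS => ->.
have Y_out k : l < k -> Y k = set0 by move=> lk; rewrite /Y ltnNge lk.
have boundaries : \sum_(0 <= k < m.+1) boundary e (Y k) (Y k) = l.+1 * boundary e A A.
  rewrite (big_cat_nat (n := l.+1)) //= [X in _ + X]big_nat [X in _ + X]big1 ?addn0.
    rewrite -[l.+1 in RHS]subn0 -sum_nat_const_nat.
    by apply: eq_big_nat => k /andP[_ kl]; rewrite Y_in.
  by move=> k /andP[lk _]; rewrite Y_out // boundary0.
have inner_crossings : \sum_(0 <= k < l) crossing e (Y k) (Y k.+1) = l * (2 * boundary e A A).
  rewrite -[l in RHS]subn0 -sum_nat_const_nat.
  by apply: eq_big_nat => k /andP[_ kl]; rewrite !Y_in ?(ltnW kl) // mul2n -addnn.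
have last_crossing : \sum_(l <= k < m) crossing e (Y k) (Y k.+1) = (l < m) * volume e A.
  have [ml|l_lt_m] := leqP m l; first by rewrite big_geq.
  rewrite big_ltn // Y_in // Y_out // crossingC crossing0 mul1n big_nat big1 ?addn0 // => k.
  by case/andP=> lk _; rewrite !Y_out ?(leqW lk) // crossing0 /volume big_set0.
rewrite /layer_cut boundaries (big_cat_nat (n := l)) //= inner_crossings last_crossing.
lia.
Qed.

Hypothesis e_sym : symmetric e.

Lemma volume_telescope Y i j : i <= j ->
  volume e (Y j) <= volume e (Y i) + \sum_(i <= k < j) crossing e (Y k) (Y k.+1).
Proof.
elim: j => [|j IH]; first by rewrite leqn0 => /eqP->; rewrite big_geq ?addn0.
rewrite leq_eqVlt => /predU1P[->|]; first by rewrite big_geq ?addn0.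
rewrite ltnS => ij; rewrite big_nat_recr //= addnA.
by apply: leq_trans (volume_le_crossing e_sym (Y j) _) _; rewrite leq_add2r IH.
Qed.

Hypothesis e_irr : irreflexive e.

Lemma layer_cut_empty_full m Y i j : i <= m -> j <= m -> Y i = set0 -> Y j = [set: T] ->
  #|T| + 2 * nedges e <= layer_cut m Y.
Proof.
wlog ij : i j Y / i <= j => [wlog_le im jm Yi Yj|].
  have [ij|/ltnW ji] := leqP i j; first exact: (wlog_le i j).
  rewrite -layer_cut_rev; apply: (wlog_le (m - i) (m - j)); rewrite ?leq_subr ?subKn //.
  exact: leq_sub2l.
move=> _ jm Yi Yj; rewrite -volume_setT // -Yj.
apply: leq_trans (volume_telescope Y ij) _; rewrite Yi {1}/volume big_set0 add0n.
exact: leq_trans (leq_sum_subrange _ (leq0n i) jm) (leq_addl _ _).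
Qed.

Hypotheses (e_conn : connected e) (T_gt1 : 1 < #|T|).

Lemma layer_cut_proper m Y : (forall k, k <= m -> proper_side (Y k)) ->
  (3 * m + 1) * edge_conn e <= layer_cut m Y.
Proof.
move=> pY.
have boundaries : m.+1 * edge_conn e <= \sum_(0 <= k < m.+1) boundary e (Y k) (Y k).
  rewrite -[m.+1 in leqLHS]subn0 -sum_nat_const_nat big_nat [leqRHS]big_nat.
  apply: leq_sum => k /andP[_ km].
  exact/edge_conn_le/pY.
have crossings : m * (2 * edge_conn e) <= \sum_(0 <= k < m) crossing e (Y k) (Y k.+1).
  rewrite -[m in leqLHS]subn0 -sum_nat_const_nat big_nat [leqRHS]big_nat.
  apply: leq_sum => k /andP[_ km].
  by apply: crossing_ge_edge_conn; rewrite ?pY // ltnW.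
rewrite /layer_cut; lia.
Qed.

Lemma layer_cut_first_nonempty m Y k : no_isolated_layers m Y ->
  (forall k, k <= m -> Y k != [set: T]) ->
  k < m -> Y k = set0 -> Y k.+1 != set0 ->
  minn (2 * min_edge_deg e + 4) (5 * min_deg e + 1) <= layer_cut m Y.
Proof.
move=> iY fY km Yk Yk1; rewrite geq_min /layer_cut.
have cross_k : crossing e (Y k) (Y k.+1) = volume e (Y k.+1) by rewrite Yk crossing0.
have [[u [v [uY vY euv]]]|[l [lm kl Yl]]] := iY _ km Yk1; apply/orP; [left|right].
  have := one_layer_ge_min_edge_deg e_sym e_conn T_gt1 e_irr uY vY euv.
  have := leq_sum_subrange (fun k => boundary e (Y k) (Y k)) (leq0n k.+1) (km : k.+2 <= m.+1).
  have := leq_sum_subrange (fun k => crossing e (Y k) (Y k.+1)) (leq0n k) km.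
  rewrite !big_nat1 cross_k; lia.
have l_above : l = k.+2 by case/orP: kl Yl => /eqP // -[->]; rewrite Yk eqxx.
rewrite l_above in lm Yl.
have proper1 : proper_side (Y k.+1) by rewrite /proper_side Yk1 fY.
have proper2 : proper_side (Y k.+2) by rewrite /proper_side Yl fY.
have := two_layers_ge_min_deg e_sym e_conn T_gt1 e_irr proper1 proper2.
have := leq_sum_subrange (fun k => boundary e (Y k) (Y k)) (leq0n k.+1) (lm : k.+3 <= m.+1).
have := leq_sum_subrange (fun k => crossing e (Y k) (Y k.+1)) (leq0n k) lm.
rewrite (big_ltn (leqnSn k.+1)) (big_ltn (leqnSn k.+2)) !big_nat1 cross_k; lia.
Qed.

Lemma layer_cut_empty_nonempty m Y i j : no_isolated_layers m Y ->
  (forall k, k <= m -> Y k != [set: T]) ->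
  i <= m -> j <= m -> Y i = set0 -> Y j != set0 ->
  minn (2 * min_edge_deg e + 4) (5 * min_deg e + 1) <= layer_cut m Y.
Proof.
wlog ij : i j Y / i <= j => [wlog_le iY fY im jm Yi Yj|].
  have [ij|/ltnW ji] := leqP i j; first exact: (wlog_le i j).
  rewrite -layer_cut_rev; apply: (wlog_le (m - i) (m - j)); rewrite ?leq_subr ?subKn //.
  - exact: leq_sub2l.
  - exact: no_isolated_layers_rev.
  - by move=> k km; apply: fY; rewrite leq_subr.
move=> iY fY _ jm Yi Yj; have lt_ij : i < j.
  by rewrite ltn_neqAle ij andbT; apply: contraNneq Yj => <-; rewrite Yi.
have ex_k : exists k, (i < k) && (Y k != set0) by exists j; rewrite lt_ij.
case: (ex_minnP ex_k) => -[//|k] /andP[ik Yk1] min_k.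
have km : k < m by apply: leq_trans jm; apply: min_k; rewrite lt_ij.
have Yk : Y k = set0.
  apply/eqP/contraT => Yk; have lt_ik : i < k.
    by rewrite ltn_neqAle -ltnS ik andbT; apply: contraNneq Yk => <-; rewrite Yi.
  by have := min_k k; rewrite lt_ik Yk ltnn => /(_ isT).
exact: (layer_cut_first_nonempty (k := k)).
Qed.

End Layers.

Section StrongProduct.
Variables (T1 T2 : finType) (e1 : rel T1) (e2 : rel T2).
Local Notation H := (strong e1 e2).
Implicit Types (u v : T1) (i j : T2) (A : {set T1}) (I : {set T2}) (X Y : {set T1 * T2}).

Definition slice X i : {set T1} := [set u | (u, i) \in X].

Lemma slice_setX A I i : slice (setX A I) i = if i \in I then A else set0.
Proof. by apply/setP=> u; rewrite !inE /=; case: ifP => iI; rewrite ?inE ?andbT ?andbF. Qed.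

Lemma slice_setD X Y i : slice (X :\: Y) i = slice X i :\: slice Y i.
Proof. by apply/setP=> u; rewrite !inE. Qed.

Lemma slice_setC X i : slice (~: X) i = ~: slice X i.
Proof. by apply/setP=> u; rewrite !inE. Qed.

Lemma sum_slices X (F : T1 * T2 -> nat) :
  \sum_(p in X) F p = \sum_i \sum_(u in slice X i) F (u, i).
Proof.
rewrite (exchange_big_dep predT) //= pair_big_dep /=.
by apply: eq_big => -[u i] //=; rewrite inE.
Qed.

Lemma strong_sym : symmetric e1 -> symmetric e2 -> symmetric H.
Proof. by move=> sym1 sym2 p q; rewrite /strong sym1 sym2 !(eq_sym q.1) !(eq_sym q.2). Qed.

Lemma strong_irr : irreflexive e1 -> irreflexive e2 -> irreflexive H.
Proof. by move=> irr1 irr2 p; rewrite /strong irr1 irr2 !andbF. Qed.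

Lemma closed_nbrs_strong u i :
  closed_nbrs H (u, i) = setX (closed_nbrs e1 u) (closed_nbrs e2 i).
Proof.
apply/setP=> -[v j]; rewrite !inE /strong xpair_eqE /= ![_ == u]eq_sym ![_ == i]eq_sym.
by case: (u == v); case: (i == j); case: (e1 u v); case: (e2 i j).
Qed.

Lemma boundary_strong X Y :
  boundary H X Y = \sum_i \sum_(j in closed_nbrs e2 i) boundary e1 (slice X i) (slice Y j).
Proof.
rewrite /boundary sum_slices; apply: eq_bigr => i _; rewrite [RHS]exchange_big.
apply: eq_bigr => u _ /=; rewrite closed_nbrs_strong -sum1_card sum_slices [RHS]big_mkcond.
apply: eq_bigr => j _; rewrite sum1_card slice_setD slice_setX.
by case: ifP; rewrite ?set0D ?cards0.
Qed.

Lemma no_isolated_strong X u i : no_isolated H X -> u \in slice X i ->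
  (exists2 v, v \in slice X i & e1 u v) \/ (exists2 j, slice X j != set0 & e2 i j).
Proof.
move=> iX; rewrite inE => /iX[[v j] vjX] /or3P[] /andP[] /=.
- by move=> /eqP-> ij; right; exists j => //; apply/set0Pn; exists v; rewrite inE.
- by move=> /eqP-> uv; left; exists v; rewrite ?inE.
by move=> _ ij; right; exists j => //; apply/set0Pn; exists v; rewrite inE.
Qed.

Lemma no_isolated_setX A I :
  no_isolated e1 A \/ no_isolated e2 I -> no_isolated H (setX A I).
Proof.
move=> iso [u i]; rewrite in_setX => /andP[/= uA iI].
case: iso => [/(_ u uA)[v vA uv]|/(_ i iI)[j jI ij]].
  by exists (v, i); rewrite ?in_setX /= ?vA // /strong /= eqxx uv /= orbT.
by exists (u, j); rewrite ?in_setX /= ?uA // /strong /= eqxx ij.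
Qed.

Lemma no_isolated_setXC A I : no_isolated e1 [set: T1] -> no_isolated e2 [set: T2] ->
  no_isolated H (~: setX A I).
Proof.
move=> iso1 iso2 [u i]; rewrite inE in_setX negb_and /= => /orP[uA|iI].
  have [j _ ij] := iso2 i (in_setT i).
  by exists (u, j); rewrite ?inE /= ?(negbTE uA) // /strong /= eqxx ij.
have [v _ uv] := iso1 u (in_setT u).
by exists (v, i); rewrite ?inE /= ?(negbTE iI) ?andbF // /strong /= eqxx uv /= orbT.
Qed.

End StrongProduct.

Lemma path_rel_sym n : symmetric (path_rel n).
Proof. by move=> i j; rewrite /path_rel orbC. Qed.

Lemma path_rel_irr n : irreflexive (path_rel n).
Proof. by move=> i; rewrite /path_rel orbb gtn_eqF. Qed.

Lemma sum_path_closed_nbrs m (F : nat -> nat -> nat) :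
  \sum_(i < m.+1) \sum_(j in closed_nbrs (path_rel m.+1) i) F i j =
  \sum_(0 <= k < m.+1) F k k + \sum_(0 <= k < m) (F k k.+1 + F k.+1 k).
Proof.
pose near (i j : nat) := [|| j == i, i.+1 == j | j.+1 == i].
pose band i j := if near i j then F i j else 0.
transitivity (\sum_(i < m.+1) \sum_(j < m.+1) band i j).
  apply: eq_bigr => i _; rewrite big_mkcond; apply: eq_bigr => j _.
  by rewrite !inE.
elim: m => [|m IH]; first by rewrite !big_ord1 big_nat1 big_geq ?addn0.
have last_col : \sum_(i < m.+1) band i m.+1 = F m m.+1.
  rewrite big_ord_recr /= /band /near eqxx orbT big1 ?add0n // => i _.
  by case: ifP => //; have := ltn_ord i; lia.
have last_row : \sum_(j < m.+1) band m.+1 j = F m.+1 m.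
  rewrite big_ord_recr /= /band /near eqxx !orbT big1 ?add0n // => i _.
  by case: ifP => //; have := ltn_ord i; lia.
rewrite big_ord_recr /=; under eq_bigr => i _ do rewrite big_ord_recr /=.
rewrite big_split /= IH last_col big_ord_recr /= last_row /band /near eqxx /=.
rewrite [in RHS]big_nat_recr // [X in _ = _ + X]big_nat_recr //=; lia.
Qed.

Definition path_prefix n l : {set 'I_n} := [set i : 'I_n | i < l].

Lemma no_isolated_path_prefix n l : 1 < l <= n -> no_isolated (path_rel n) (path_prefix n l).
Proof.
case/andP=> l_gt1 l_le i; rewrite inE => il; case: i il => -[|i] i_lt /= il.
  by exists (Ordinal (leq_trans l_gt1 l_le)); rewrite ?inE.
by exists (Ordinal (ltnW i_lt)); rewrite ?inE /path_rel /= ?eqxx ?orbT // ltnW.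
Qed.

Lemma no_isolated_path_setT n : 1 < n -> no_isolated (path_rel n) [set: 'I_n].
Proof.
move=> n_gt1; rewrite (_ : [set: 'I_n] = path_prefix n n).
  by apply: no_isolated_path_prefix; rewrite n_gt1 leqnn.
by apply/setP=> i; rewrite !inE ltn_ord.
Qed.

Section StrongPath.
Variables (T : finType) (e : rel T) (m : nat).
Local Notation H := (strong e (path_rel m.+1)).
Implicit Types (A : {set T}) (X : {set T * 'I_m.+1}).

(* Beyond the top layer, inord is 0: for k > m this is the bottom slice again. *)
Definition layer X (k : nat) : {set T} := slice X (inord k).

Lemma boundary_strong_path X : boundary H X X = layer_cut e m (layer X).
Proof.
rewrite boundary_strong /layer_cut.
rewrite -(sum_path_closed_nbrs m (fun i j => boundary e (layer X i) (layer X j))).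
by apply: eq_bigr => i _; apply: eq_bigr => j _; rewrite /layer !inord_val.
Qed.

Lemma no_isolated_layers_strong_path X :
  no_isolated H X -> no_isolated_layers e m (layer X).
Proof.
move=> iX k km /set0Pn[u uX]; have [[v vX uv]|[l Xl kl]] := no_isolated_strong iX uX.
  by left; exists u, v.
right; exists l; rewrite leq_ord /layer inord_val; split=> //.
by move: kl; rewrite /path_rel inordK.
Qed.

Lemma layer_setX_path_prefix A l k : k <= m ->
  layer (setX A (path_prefix m.+1 l)) k = if k < l then A else set0.
Proof. by move=> km; rewrite /layer slice_setX inE inordK. Qed.

Hypotheses (e_sym : symmetric e) (e_irr : irreflexive e).
Hypotheses (e_conn : connected e) (T_gt1 : 1 < #|T|) (m_gt0 : 0 < m).

Lemma restricted_side_box A l : 0 < l <= m.+1 -> A != set0 ->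
  (A != [set: T]) || (l <= m) -> no_isolated e A \/ 1 < l ->
  restricted_side H (setX A (path_prefix m.+1 l)).
Proof.
move=> /andP[l_gt0 l_le] /set0Pn[u uA] proper_box iso; split.
- apply/proper_sideP; exists (u, ord0); case/orP: proper_box => [|l_le_m].
    rewrite -properT => /properP[_ [v _ vA]]; exists (v, ord0).
    by rewrite !inE /= uA (negbTE vA).
  by exists (u, ord_max); rewrite !inE /= uA /= -leqNgt.
- apply: no_isolated_setX; case: iso => [|l_gt1]; [by left | right].
  by apply: no_isolated_path_prefix; rewrite l_gt1.
- by apply/no_isolated_setXC/no_isolated_path_setT; first exact: connected_no_isolated_setT.
Qed.

Lemma restricted_side_strong_path : exists X, restricted_side H X.
Proof.
exists (setX [set: T] (path_prefix m.+1 1)); apply: restricted_side_box => //.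
- by rewrite -card_gt0 cardsT ltnW.
- by rewrite m_gt0 orbT.
by left; apply: connected_no_isolated_setT.
Qed.

Lemma redge_conn_strong_path_le_box A l : 0 < l <= m.+1 -> A != set0 ->
  (A != [set: T]) || (l <= m) -> no_isolated e A \/ 1 < l ->
  redge_conn H <= (3 * l - 2) * boundary e A A + (l <= m) * volume e A.
Proof.
move=> l_bounds A0 proper_box iso; rewrite -layer_cut_prefix //.
rewrite -(eq_layer_cut e (@layer_setX_path_prefix A l)) -boundary_strong_path.
apply: redge_conn_le; last exact: restricted_side_box.
  exact/strong_sym/path_rel_sym.
exact/strong_irr/path_rel_irr.
Qed.

Lemma redge_conn_strong_path_le_edge_conn : redge_conn H <= (3 * m + 1) * edge_conn e.
Proof.
have [A /andP[A0 AT] <-] := edge_conn_attained e_sym T_gt1.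
have := @redge_conn_strong_path_le_box A m.+1; rewrite AT leqnn ltnn addn0.
by move=> /(_ isT A0 isT (or_intror m_gt0)); rewrite (_ : 3 * m.+1 - 2 = 3 * m + 1) //; lia.
Qed.

Lemma redge_conn_strong_path_le_volume : redge_conn H <= #|T| + 2 * nedges e.
Proof.
have T0 : [set: T] != set0 by rewrite -card_gt0 cardsT ltnW.
have := @redge_conn_strong_path_le_box [set: T] 1.
rewrite boundaryT volume_setT // m_gt0 orbT muln0 mul1n; apply=> //.
by left; apply: connected_no_isolated_setT.
Qed.

Lemma redge_conn_strong_path_le_min_edge_deg : redge_conn H <= 2 * min_edge_deg e + 4.
Proof.
have /card_gt1P[x _] := T_gt1.
have [y _ exy] := connected_no_isolated_setT e_sym e_conn T_gt1 (in_setT x).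
have [u [v [euv <-]]] := min_edge_deg_attained exy; have evu : e v u by rewrite e_sym.
have iso_uv : no_isolated e [set u; v].
  by move=> w /set2P[]->; [exists v | exists u]; rewrite ?set21 ?set22.
have uv0 : [set u; v] != set0 by apply/set0Pn; exists u; rewrite set21.
have neq_uv : u \notin [set v] by rewrite inE; apply: contraTneq euv => ->; rewrite e_irr.
have := @redge_conn_strong_path_le_box [set u; v] 1.
rewrite m_gt0 orbT => /(_ isT uv0 isT (or_introl iso_uv)).
rewrite boundary_set2 // /volume big_setU1 //= !big_set1 !card_closed_nbrs //.
have := deg_gt0 euv; have := deg_gt0 evu; lia.
Qed.

Lemma redge_conn_strong_path_le_min_deg : redge_conn H <= 5 * min_deg e + 1.
Proof.
have [u <-] := min_deg_attained e (ltnW T_gt1).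
have /andP[u0 uT] := proper_side1 u T_gt1.
have := @redge_conn_strong_path_le_box [set u] 2; rewrite uT => /(_ m_gt0 u0 isT (or_intror isT)).
rewrite boundary_set1 // /volume big_set1 card_closed_nbrs //.
by case: (1 < m); lia.
Qed.

Lemma boundary_strong_path_empty_slice_ge X (i : 'I_m.+1) : restricted_side H X ->
  (forall j : 'I_m.+1, slice X j != [set: T]) -> slice X i = set0 ->
  minn (2 * min_edge_deg e + 4) (5 * min_deg e + 1) <= boundary H X X.
Proof.
case=> /andP[/set0Pn[[u j] uX] _] iX _ fX Xi; rewrite boundary_strong_path.
apply: (layer_cut_empty_nonempty _ _ _ _ (i := i) (j := j)) => //.
- exact: no_isolated_layers_strong_path.
- by move=> k _; apply: fX.
- exact: leq_ord.
- exact: leq_ord.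
- by rewrite /layer inord_val.
by apply/set0Pn; exists u; rewrite /layer inord_val inE.
Qed.

Lemma boundary_strong_path_ge X : restricted_side H X ->
  minn (minn ((3 * m + 1) * edge_conn e) (#|T| + 2 * nedges e))
       (minn (2 * min_edge_deg e + 4) (5 * min_deg e + 1)) <= boundary H X X.
Proof.
move=> rX; have H_sym : symmetric H by exact/strong_sym/path_rel_sym.
have [/existsP[i /eqP Xi]|/existsPn no_empty] := boolP [exists i, slice X i == set0];
have [/existsP[j /eqP Xj]|/existsPn no_full] := boolP [exists j, slice X j == [set: T]].
- rewrite boundary_strong_path !geq_min (_ : _ + _ <= _) ?orbT //.
  by apply: (layer_cut_empty_full _ _ (i := i) (j := j)); rewrite /layer ?inord_val ?leq_ord.
- by rewrite geq_min (boundary_strong_path_empty_slice_ge rX no_full Xi) orbT.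
- rewrite -(boundary_setC H_sym) geq_min orbC.
  rewrite (@boundary_strong_path_empty_slice_ge _ j) ?slice_setC ?Xj ?setCT //.
    exact: restricted_sideC.
  by move=> i; rewrite slice_setC (can2_eq setCK setCK) setCT no_empty.
rewrite boundary_strong_path !geq_min layer_cut_proper // => k _.
by rewrite /proper_side no_empty no_full.
Qed.

End StrongPath.

Theorem theorem3p1 (T : finType) (e : rel T) (n : nat) :
  symmetric e -> irreflexive e ->
  1 < #|T| -> connected e -> 2 <= n ->
  redge_conn (strong e (path_rel n)) =
  minn (minn ((3 * n - 2) * edge_conn e) (#|T| + 2 * nedges e))
       (minn (2 * min_edge_deg e + 4) (5 * min_deg e + 1)).
Proof.
move=> e_sym e_irr T_gt1 e_conn; case: n => // m m_gt0.
have -> : 3 * m.+1 - 2 = 3 * m + 1 by lia.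
have H_sym := strong_sym e_sym (@path_rel_sym m.+1).
have H_irr := strong_irr e_irr (@path_rel_irr m.+1).
have [X0 restricted_X0] := restricted_side_strong_path e_sym e_conn T_gt1 m_gt0.
have [X restricted_X min_X] := redge_conn_attained H_sym H_irr restricted_X0.
apply/eqP; rewrite eqn_leq !leq_min; apply/andP; split.
  by rewrite redge_conn_strong_path_le_edge_conn ?redge_conn_strong_path_le_volume
    ?redge_conn_strong_path_le_min_edge_deg ?redge_conn_strong_path_le_min_deg.
by rewrite -min_X boundary_strong_path_ge.
Qed.
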